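(* Consider the online hiring problem with costs drawn i.i.d. from the uniform distribution $U[0,1]$, and let $c=3/4$. The following online algorithm (Algorithm 2) is strictly $2.965$-competitive. Initialize $\tau\leftarrow 1$ and $t\leftarrow 1$. For $i=1,\dots,n$: set $t\leftarrow t-1$; if $x_i\le\tau$, then while $x_i\le\tau$ set $\tau\leftarrow\tau/2$; afterwards hire applicant $i$ for $\lceil 2c/\tau\rceil$ time steps, and if $i+\lceil 2c/\tau\rceil>n$ stop, otherwise set $t\leftarrow\lceil c/\tau\rceil$; else, if $t=0$, set $\tau\leftarrow 2\tau$ and $t\leftarrow\lceil c/\tau\rceil$.
   Context: Online hiring problem: there are $n$ time steps; in time step $i$ applicant $i$ arrives and its cost $x_i$ is revealed, where $x_1,\dots,x_n$ are drawn independently from a distribution $X$. Immediately and irrevocably at time $i$, based only on $x_1,\dots,x_i$ and earlier decisions, the algorithm chooses a nonnegative integer duration $t_i$; applicant $i$ is then under contract during time steps $i,\dots,i+t_i-1$. At every time step $s\in\{1,\dots,n\}$ at least one applicant must be under contract. The cost is $\sum_i t_ix_i$; $\textsc{Alg}_n$ denotes the cost of the online algorithm and $\textsc{Opt}_n$ the minimum cost of a feasible solution knowing all $x_1,\dots,x_n$ in advance. An online algorithm is strictly $c'$-competitive if $\sup_{n\in\mathbb{N}}\mathbf{E}[\textsc{Alg}_n]/\mathbf{E}[\textsc{Opt}_n]\le c'$.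
   Formalization: With contracts charged in full the claim fails for n = 1 (E[Alg_1] = 9/4, E[Opt_1] = 1/2); it is proved for all n ≥ 2 as stated, and for all n ≥ 1 when contracts are cut off at time step n. *)

(* Defs.v *)
From mathcomp Require Import all_boot all_order all_algebra.
From mathcomp Require Import archimedean finmap.
From mathcomp Require Import all_classical all_reals all_analysis.

Set Implicit Arguments.
Unset Strict Implicit.
Unset Printing Implicit Defensive.

Import Order.TTheory GRing.Theory Num.Theory.
Import numFieldNormedType.Exports.

Local Open Scope classical_set_scope.
Local Open Scope ring_scope.

(* Applicants and time steps are numbered from 1: an instance of length n is
   x 1, ..., x n, and the values of x and t elsewhere are never used. *)

Section Hiring.
Variable R : realType.
Implicit Types (n i s : nat) (x : nat -> R) (t : nat -> nat).

Definition under_contract t i s : Prop := (i <= s < i + t i)%N.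

Definition feasible n t : Prop :=
  forall s, (1 <= s <= n)%N ->
    exists i, (1 <= i <= n)%N /\ under_contract t i s.

Definition cost n x t : R := \sum_(1 <= i < n.+1) (t i)%:R * x i.

(* For nonnegative costs this infimum is attained. *)
Definition Opt n x : R := inf [set cost n x t | t in feasible n].

(* [A n [:: x 1; ...; x i]] is the duration chosen at time i. Earlier decisions
   are functions of earlier costs, so they need not be passed separately. *)
Definition online_algorithm := nat -> seq R -> nat.

Definition durations (A : online_algorithm) n x : nat -> nat :=
  fun i => A n [seq x j | j <- iota 1 i].

Definition Alg (A : online_algorithm) n x : R := cost n x (durations A n x).

(* Contracts do not extend beyond time step n. *)
Definition truncated (A : online_algorithm) : online_algorithm :=
  fun n xs => minn (A n xs) (n.+1 - size xs).

End Hiring.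

Section Competitiveness.
Context d (T : measurableType d) (R : realType) (P : probability T R).
Implicit Types (X : nat -> {RV P >-> R}) (A : online_algorithm R).

Definition mutually_independent X : Prop :=
  forall (J : {fset nat}) (E : nat -> set R),
    (forall j, measurable (E j)) ->
    P (\bigcap_(j in [set` J]) (X j @^-1` E j)) =
    (\prod_(j <- J) P (X j @^-1` E j))%E.

Definition iid X (mu : set R -> \bar R) : Prop :=
  mutually_independent X /\
  forall i (E : set R), measurable E -> distribution P (X i) E = mu E.

Definition ratio X A n : \bar R :=
  ('E_P[fun w => Alg A n (X ^~ w)] / 'E_P[fun w => Opt n (X ^~ w)])%E.

Definition competitive_on (N : set nat) X A (c : R) : Prop :=
  (forall n, N n -> {ae P, forall w, feasible n (durations A n (X ^~ w))}) /\
  (ereal_sup [set ratio X A n | n in N] <= c%:E)%E.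

Definition strictly_competitive := competitive_on [set n | (1 <= n)%N].

End Competitiveness.

(* The result of [while guard do body], started in s. If the loop does not
   terminate the value is s. *)
Definition while (S : Type) (guard : pred S) (body : S -> S) (s : S) : S :=
  if pselect (exists k, ~~ guard (iter k body s)) is left ex
  then iter (ex_minn ex) body s else s.

Section Algorithm2.
Variables (R : realType) (c : R).

Record state := State { threshold : R; clock : nat; stopped : bool }.

(* For u >= 0 this is the ceiling of u. *)
Definition ceiln (u : R) : nat := `|Num.ceil u|%N.

(* Time step i of n with cost x: the new state and the duration of the contract
   offered to applicant i (0 if not hired). For x > 0 the loop terminates; costs
   x <= 0 have probability zero under U[0,1]. *)
Definition step (n i : nat) (x : R) (st : state) : state * nat :=
  let: State tau t stop := st in
  if stop then (st, 0%N) else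
  let t := t.-1 in
  if x <= tau then
    let tau := while (fun u => x <= u) (fun u => u / 2) tau in
    let l := ceiln (2 * c / tau) in
    if (n < i + l)%N then (State tau t true, l)
    else (State tau (ceiln (c / tau)) false, l)
  else if t == 0%N then
    let tau := 2 * tau in (State tau (ceiln (c / tau)) false, 0%N)
  else (State tau t false, 0%N).

(* [run n i st l xs]: process the costs xs of applicants i, i + 1, ... from
   state st, and return the last duration chosen (l if xs is empty). *)
Fixpoint run (n i : nat) (st : state) (l : nat) (xs : seq R) : nat :=
  if xs is x :: xs' then
    let: (st', l') := step n i x st in run n i.+1 st' l' xs'
  else l.

Definition algorithm2 : online_algorithm R :=
  fun n xs => run n 1 (State 1 1 false) 0 xs.

End Algorithm2.

(* Main.v *)
(* Thresholds are 2^-j. A contract signed when the threshold has dropped to 2^-k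
   lasts 3 * 2^(k-1) steps, exactly the time in which the threshold climbs back
   to 1 if nobody is hired, so there is always someone under contract. The hired
   cost is uniform on ]2^-k, 2^-(k-1)], hence every contract costs 9/4 on
   average, and it remains to count hires. If [hires j] bounds the number of
   hires from one made at threshold 2^-j on, then from state (j, t) (threshold
   2^-j, t steps left on the clock) it is at most
     hires j + (1 - 2^-j)^t * rho j,
   where (1 - 2^-j)^t is the probability that the clock runs out. With t the
   initial clock the correction is at most [delta j], which makes
   hires j - hires (j+1) = (1 + delta (j+1)) / 2. Contracts of length about n end
   the process, so only log_2 (n/3) thresholds matter.
   The optimum is at least the sum over s of min (x_1, ..., x_s), whose
   expectation is the sum of the 1/(s+1). Since 9/4 * (1 + delta) / 2 is less
   than 2.965 * ln 2 in the limit, the comparison reduces to finitely many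
   values of n. *)

Require Import Defs.
From mathcomp Require Import all_boot all_order all_algebra.
From mathcomp Require Import finmap zify ring lra.
From mathcomp Require Import all_classical all_reals all_analysis.
From mathcomp Require Import measurable_realfun.

Set Implicit Arguments.
Unset Strict Implicit.
Unset Printing Implicit Defensive.

Import Order.TTheory GRing.Theory Num.Theory.

Local Open Scope classical_set_scope.
Local Open Scope ring_scope.

(** * Expectations of functions not known to be measurable *)

Section NonMeasurableExpectation.
Context d (T : measurableType d) (R : realType) (P : probability T R).
Local Open Scope ereal_scope.
Import HBNNSimple.

(* The integral is a supremum over simple functions, so monotonicity needs
   measurability of one side only. *)
Lemma ae_le_integral_nneg (f F : T -> \bar R) :
  (forall w, 0 <= f w) -> (forall w, 0 <= F w) -> measurable_fun setT F ->
  {ae P, forall w, f w <= F w} -> \int[P]_w f w <= \int[P]_w F w.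
Proof.
move=> f0 F0 mF fF; rewrite ge0_integralTE//.
apply: ge_ereal_sup => _ [h hf <-].
rewrite -integralT_nnsfun; apply: ae_ge0_le_integral => //.
- by move=> w _; rewrite lee_fin.
- by apply/measurable_EFinP.
- by apply: filterS fF => w fFw _; exact: le_trans (hf w) fFw.
Qed.

Lemma ge0_le_integral_nonmeas (f F : T -> \bar R) :
  (forall w, 0 <= f w) -> (forall w, f w <= F w) ->
  \int[P]_w f w <= \int[P]_w F w.
Proof.
move=> f0 fF; have F0 w : 0 <= F w by exact: le_trans (f0 w) (fF w).
rewrite !ge0_integralTE//; apply: le_ereal_sup => _ [h hf <-].
by exists h => // w; exact: le_trans (hf w) (fF w).
Qed.

Lemma le_expectation_ae (f : T -> R) (F : T -> \bar R) :
  (forall w, 0 <= F w) -> measurable_fun setT F ->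
  {ae P, forall w, (f w)%:E <= F w} -> 'E_P[f] <= \int[P]_w F w.
Proof.
move=> F0 mF fF; rewrite unlock integralE.
have le1 : \int[P]_w (EFin \o f)^\+ w <= \int[P]_w F w.
  apply: ae_le_integral_nneg => //.
  by apply: filterS fF => w fw; rewrite funeposE /= ge_max fw F0.
have ge0 : 0 <= \int[P]_w (EFin \o f)^\- w by exact: integral_ge0.
by apply: le_trans le1; rewrite -[leRHS]adde0 leeD// oppe_le0.
Qed.

(** Here the smaller side is the measurable one: the negligible set where the bound fails is removed
    from the integral of [G], and extension by zero leaves a pointwise comparison with the positive
    part of [f]. *)
Lemma ge_expectation_ae (f : T -> R) (G : T -> \bar R) :
  (forall w, 0 <= G w) -> measurable_fun setT G ->
  {ae P, forall w, G w <= (f w)%:E} -> \int[P]_w G w <= 'E_P[f].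
Proof.
move=> G0 mG Gf.
have neg0 : \int[P]_w (EFin \o f)^\- w = 0.
  apply/eqP; rewrite eq_le integral_ge0// andbT.
  rewrite -[leRHS](integral0 P setT); apply: ae_le_integral_nneg => //.
  apply: filterS Gf => w fw; rewrite funenegE /= ge_max lexx andbT.
  by rewrite lee_fin oppr_le0 -lee_fin; exact: le_trans fw.
have -> : 'E_P[f] = \int[P]_w (EFin \o f)^\+ w.
  by rewrite unlock integralE -[RHS]sube0; congr (_ - _); exact: neg0.
case: Gf => N [mN N0 GN].
rewrite (ge0_negligible_integral _ _ _ _ N0)//.
rewrite integral_mkcond setTD; apply: ge0_le_integral_nonmeas => w.
  by rewrite erestrict_ge0.
rewrite patchE; case: ifPn => [|_]; last by rewrite funeposE le_max lexx orbT.
rewrite inE => nNw; rewrite funeposE /= le_max; apply/orP; left.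
by apply: contrapT => nG; apply: nNw; exact: GN.
Qed.

End NonMeasurableExpectation.

(** * Conditional bounds for i.i.d. uniform costs *)

Section IidUniform.
Context d (T : measurableType d) (R : realType) (P : probability T R).
Variables (X : nat -> {RV P >-> R}) (iidX : iid X (uniform_prob (@ltr01 R))).

Lemma uniform01_itv (a b : R) : 0 <= a -> a <= b -> b <= 1 ->
  uniform_prob (@ltr01 R) `]a, b] = (b - a)%:E.
Proof.
move=> a0 ab b1; rewrite /uniform_prob (eq_integral (fun=> 1%:E)); last first.
  move=> x; rewrite inE/= in_itv/= /uniform_pdf => /andP[ax xb].
  by rewrite (ltW (le_lt_trans a0 ax)) (le_trans xb b1) subr0 invr1.
rewrite integral_cst//= mul1e lebesgue_measure_itv/= lte_fin.
by case: ltP => // ba; rewrite (le_anti (_ : a <= b <= a)) ?subrr// ab.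
Qed.

Lemma measurable_rv_preimage i (E : set R) :
  measurable E -> measurable (X i @^-1` E).
Proof. by move=> mE; rewrite -[_ @^-1` _]setTI; exact: measurable_funP. Qed.

Lemma prob_rv_itv i (a b : R) : 0 <= a -> a <= b -> b <= 1 ->
  P (X i @^-1` `]a, b]) = (b - a)%:E.
Proof.
by move=> a0 ab b1; rewrite -(uniform01_itv a0 ab b1) -(iidX.2 i).
Qed.

Definition unit_valued w := forall i, 0 < X i w <= 1.

Lemma ae_unit_valued : {ae P, forall w, unit_valued w}.
Proof.
apply/ae_foralln => i; exists (~` (X i @^-1` `]0, 1])); split.
- exact/measurableC/measurable_rv_preimage.
- have := probability_setC P (measurable_rv_preimage i (measurable_itv `]0, 1])).
  by rewrite prob_rv_itv// subr0 subee.
- by move=> w /= h; rewrite in_itv.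
Qed.

Definition box (E : nat -> set R) i : set T :=
  \bigcap_(j in [set j | (j < i)%N]) (X j @^-1` E j).

Lemma measurable_box E i : (forall j, measurable (E j)) -> measurable (box E i).
Proof.
by move=> mE; apply: bigcap_measurableType => j _; exact: measurable_rv_preimage.
Qed.

Lemma box_setT i : box (fun=> setT) i = setT.
Proof. by apply/seteqP; split. Qed.

Lemma prob_box E i : (forall j, measurable (E j)) ->
  P (box E i) = (\prod_(j < i) P (X j @^-1` E j))%E.
Proof.
move=> mE; have := iidX.1 (seq_fset tt (iota 0 i)) E mE.
rewrite (_ : [set` _] = [set j | (j < i)%N]); last first.
  by apply/seteqP; split => j; rewrite /mkset seq_fsetE mem_iota.
rewrite -/(box E i) => ->.
rewrite (perm_big (iota 0 i)); last first.
  by rewrite (perm_trans (seq_fset_perm _ _))// undup_id// iota_uniq.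
by rewrite -(big_mkord xpredT (fun j => P (X j @^-1` E j))) /index_iota subn0.
Qed.

Lemma boxI E i (I : set R) :
  box E i `&` X i @^-1` I = box (fun j => if j == i then I else E j) i.+1.
Proof.
apply/seteqP; split => w /= => [[h hi] j /=|h].
  rewrite ltnS leq_eqVlt; case: eqVneq => [-> _|_ /= ji]; first exact: hi.
  exact: h.
split; last by have := h i; rewrite /= eqxx; exact.
move=> j /= ji; have := h j; rewrite /= (ltn_eqF ji); apply.
exact: leq_trans ji _.
Qed.

Lemma prob_boxI E i (a b : R) : (forall j, measurable (E j)) ->
  0 <= a -> a <= b -> b <= 1 ->
  P (box E i `&` X i @^-1` `]a, b]) = (P (box E i) * (b - a)%:E)%E.
Proof.
move=> mE a0 ab b1; rewrite boxI !prob_box//; last first.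
  by move=> j; case: ifP.
rewrite big_ord_recr/= eqxx prob_rv_itv//; congr (_ * _)%E.
by apply: eq_bigr => j _; rewrite ltn_eqF.
Qed.

(* [v] bounds the conditional expectation of [f] given any event about the
   costs of the applicants before [i]; [f] itself need not be measurable. *)
Definition cond_le i (f : T -> R) (v : R) := exists F : T -> \bar R,
  [/\ forall w, (0 <= F w)%E, measurable_fun setT F,
      forall w, unit_valued w -> ((f w)%:E <= F w)%E &
      forall E, (forall j, measurable (E j)) ->
        (\int[P]_(w in box E i) F w <= P (box E i) * v%:E)%E].

(** The bound is not normalised by the probability of the interval: [v] contains the factor [b - a],
    so that bounds on adjacent intervals add up. *)
Definition cond_le_itv i (a b : R) (f : T -> R) (v : R) :=
  exists F : T -> \bar R,
  [/\ forall w, (0 <= F w)%E, measurable_fun setT F,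
      forall w, unit_valued w -> a < X i w <= b -> ((f w)%:E <= F w)%E &
      forall E, (forall j, measurable (E j)) ->
        (\int[P]_(w in box E i `&` X i @^-1` `]a, b]) F w
           <= P (box E i) * v%:E)%E].

Lemma expectation_le_cond i f v : cond_le i f v -> ('E_P[f] <= v%:E)%E.
Proof.
move=> [F [F0 mF fF IF]]; apply: le_trans (le_expectation_ae F0 mF _) _.
  by apply: filterS ae_unit_valued => w /fF.
have := IF (fun=> setT) (fun=> measurableT).
by rewrite box_setT probability_setT mul1e.
Qed.

Lemma cond_le0 i (f : T -> R) (v : R) : 0 <= v ->
  (forall w, unit_valued w -> f w <= 0) -> cond_le i f v.
Proof.
move=> v0 f0; exists (cst 0%E); split => //=.
by move=> E mE; rewrite integral0 mule_ge0// lee_fin.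
Qed.

Lemma cond_le_itv_mono i a b f (u v : R) : u <= v ->
  cond_le_itv i a b f u -> cond_le_itv i a b f v.
Proof.
move=> uv [F [F0 mF fF IF]]; exists F; split => // E mE.
by apply: le_trans (IF E mE) _; rewrite lee_wpmul2l// lee_fin.
Qed.

Lemma cond_le_of_itv i f v : cond_le_itv i 0 1 f v -> cond_le i f v.
Proof.
move=> [F [F0 mF fF IF]].
have mI : measurable (X i @^-1` `]0, 1]) by exact: measurable_rv_preimage.
exists (F \_ (X i @^-1` `]0, 1])); split.
- by move=> w; rewrite erestrict_ge0.
- by apply/(measurable_restrictT _ mI); exact: measurable_funTS.
- move=> w gw; rewrite patchE mem_set; first exact: fF (gw i).
  by rewrite /= in_itv; exact: gw.
- by move=> E mE; rewrite -integral_mkcondr; exact: IF.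
Qed.

Lemma cond_le_itv_glue i (a b c u v : R) f : a <= b -> b <= c ->
  cond_le_itv i a b f u -> cond_le_itv i b c f v -> cond_le_itv i a c f (u + v).
Proof.
move=> ab bc [F [F0 mF fF IF]] [G [G0 mG fG IG]].
exists (fun w => if X i w <= b then F w else G w); split.
- by move=> w; case: ifP.
- apply: measurable_fun_ifT => //.
  exact: measurable_fun_ler.
- move=> w gw /andP[aX Xc]; case: (leP (X i w) b) => bX.
    by apply: (fF w gw); rewrite aX.
  by apply: (fG w gw); rewrite bX.
move=> E mE; have mB := measurable_box i mE.
rewrite (_ : _ `&` _ = (box E i `&` X i @^-1` `]a, b]) `|`
                       (box E i `&` X i @^-1` `]b, c])); last first.
  rewrite -setIUr -preimage_setU; congr (_ `&` _ @^-1` _).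
  apply/seteqP; split => x /=; rewrite !in_itv/=.
    by case/andP => -> ->; rewrite andbT; case: (leP x b) => _; [left|right].
  by case=> /andP[ax xb]; rewrite ?ax ?xb ?andbT ?(le_trans xb) ?(le_lt_trans ab).
have mI x y : measurable (box E i `&` X i @^-1` `]x, y]).
  by apply: measurableI => //; exact: measurable_rv_preimage.
rewrite ge0_integral_setU//=; last 3 first.
- apply: measurable_funTS; apply: measurable_fun_ifT => //.
  exact: measurable_fun_ler.
- by move=> w _; case: ifP.
- apply/disj_setPS => w [[_ +] [_]]; rewrite /= !in_itv/= => /andP[_ xb] /andP[].
  by rewrite ltNge xb.
rewrite EFinD muleDr ?fin_num_measure//.
apply: leeD; [apply: le_trans (IF E mE)|apply: le_trans (IG E mE)].
- rewrite le_eqVlt; apply/orP; left; apply/eqP; apply: eq_integral => w.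
  by rewrite inE/= in_itv/= => -[_ /andP[_ ->]].
- rewrite le_eqVlt; apply/orP; left; apply/eqP; apply: eq_integral => w.
  by rewrite inE/= in_itv/= => -[_ /andP[+ _]]; rewrite ltNge => /negbTE ->.
Qed.

(** By independence the event [a < X i <= b] contributes the factor [b - a]; intersected with a box
    it is a box for [i.+1], to which the bound on [g] applies. *)
Lemma cond_le_itv_leaf i (a b K v : R) (f g : T -> R) :
  0 <= a -> a <= b -> b <= 1 -> 0 <= K ->
  (forall w, unit_valued w -> a < X i w <= b -> f w <= K + g w) ->
  cond_le i.+1 g v -> cond_le_itv i a b f ((b - a) * (K + v)).
Proof.
move=> a0 ab b1 K0 fg [G [G0 mG gG IG]].
exists (fun w => K%:E + G w)%E; split.
- by move=> w; rewrite adde_ge0.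
- by apply: emeasurable_funD => //; exact: measurable_cst.
- move=> w gw hw; apply: le_trans (_ : (K + g w)%:E <= _)%E.
    by rewrite lee_fin fg.
  by rewrite EFinD leeD2l// gG.
move=> E mE; have mB := measurable_box i mE.
have mI : measurable (box E i `&` X i @^-1` `]a, b]).
  by apply: measurableI => //; exact: measurable_rv_preimage.
rewrite ge0_integralD//; last exact: measurable_funTS.
rewrite integral_cst// EFinM muleA -prob_boxI// EFinD muleDr ?fin_num_measure//.
rewrite muleC leeD2l// boxI; apply: IG => j.
by case: ifP.
Qed.

(* Bisecting [N] times makes the upper Riemann sum of [x] over [a, b] exceed
   the integral by [(b - a)^2 / 2^(N+1)]. *)
Lemma cond_le_itv_linear N i (a b L v : R) (f g : T -> R) :
  0 <= a -> a <= b -> b <= 1 -> 0 <= L ->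
  (forall w, unit_valued w -> a < X i w <= b -> f w <= L * X i w + g w) ->
  cond_le i.+1 g v ->
  cond_le_itv i a b f
    ((b - a) * (L * ((a + b) / 2 + (b - a) / 2 ^+ N.+1) + v)).
Proof.
move=> + + + L0 + gv; elim: N a b => [|N IH] a b a0 ab b1 fg.
  apply: cond_le_itv_mono (cond_le_itv_leaf (K := L * b) a0 ab b1 _ _ gv).
  - by apply: ler_wpM2l; rewrite ?subr_ge0// lerD2r ler_wpM2l// expr1; lra.
  - by apply: mulr_ge0 => //; exact: le_trans ab.
  - move=> w gw /[dup] hw /andP[_ Xb]; apply: le_trans (fg w gw hw) _.
    by rewrite lerD2r ler_wpM2l.
have am : a <= (a + b) / 2 by lra.
have mb : (a + b) / 2 <= b by lra.
apply: cond_le_itv_mono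
  (cond_le_itv_glue am mb (IH _ _ a0 am (le_trans mb b1) _)
                          (IH _ _ (le_trans a0 am) mb b1 _)).
- rewrite le_eqVlt; apply/orP; left; apply/eqP.
  rewrite [2 ^+ N.+2]exprS.
  have : 2 ^+ N.+1 != 0 :> R by rewrite expf_neq0// pnatr_eq0.
  by move: (2 ^+ N.+1) => p p0; field.
- by move=> w gw /andP[aX Xm]; apply: fg => //; rewrite aX (le_trans Xm mb).
- by move=> w gw /andP[mX Xb]; apply: fg => //; rewrite (le_lt_trans am mX).
Qed.

End IidUniform.

(** * Deterministic behaviour of the algorithm *)

Section Dynamics.
Variable R : realType.
Implicit Types (n i j k t l s : nat) (x : nat -> R).

(* [clk j] is the clock set at threshold [2^-j]; [hire_len k] is the length of
   a contract signed when the threshold drops to [2^-(k+1)]; once the clock at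
   [2^-j] has run out, somebody is hired within [csum j] steps. *)
Definition clk j : nat := if j is j'.+2 then 3 * 2 ^ j' else j.+1.
Definition hire_len k : nat := 3 * 2 ^ k.
Definition csum j : nat := if j is j'.+2 then 3 * 2 ^ j' else j.

Lemma csumS j : csum j.+1 = (csum j + clk j)%N.
Proof. by case: j => [|[|j]] //=; rewrite expnS; lia. Qed.

(** A contract lasts exactly as long as the climb that starts with it. The identity is exact because
    the clocks at thresholds 1 and 1/2 are rounded up to 1 and 2, with sum 3. *)
Lemma hire_len_csum k : hire_len k = (csum k.+1 + clk k.+1)%N.
Proof. by rewrite -csumS. Qed.

Lemma clk_gt0 j : (0 < clk j)%N.
Proof. by case: j => [|[|j]] //=; rewrite muln_gt0 expn_gt0. Qed.

Lemma ceiln_eq (u : R) (m : nat) : m%:R - 1 < u <= m%:R -> ceiln u = m.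
Proof.
move=> h; suff /eqP E : Num.ceil u == Posz m by rewrite /ceiln E.
by rewrite ceil_eq intrD.
Qed.

Lemma ceiln_clk j : ceiln (3 / 4 / 2 ^- j : R) = clk j.
Proof.
rewrite invrK; case: j => [|[|j]]; apply: ceiln_eq => /=.
- by rewrite expr0; lra.
- by rewrite expr1; lra.
- rewrite natrM natrX !exprS; have : 0 < 2 ^+ j :> R by rewrite exprn_gt0.
  by move: (2 ^+ j) => p p0; lra.
Qed.

Lemma ceiln_hire_len k : ceiln (2 * (3 / 4) / 2 ^- k.+1 : R) = hire_len k.
Proof.
rewrite invrK; apply: ceiln_eq; rewrite natrM natrX exprS.
have : 0 < 2 ^+ k :> R by rewrite exprn_gt0.
by move: (2 ^+ k) => p p0; lra.
Qed.

Lemma lev_gt0 j : 0 < 2 ^- j :> R.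
Proof. by rewrite invr_gt0 exprn_gt0. Qed.

Lemma lev_le j k : (j <= k)%N -> 2 ^- k <= 2 ^- j :> R.
Proof.
by move=> jk; rewrite lef_pV2 ?posrE ?exprn_gt0// ler_weXn2l// ler1n.
Qed.

Lemma lev_le1 j : 2 ^- j <= 1 :> R.
Proof. by have := lev_le (leq0n j); rewrite expr0 invr1. Qed.

Lemma levS j : 2 ^- j = 2 * 2 ^- j.+1 :> R.
Proof. by rewrite exprS invfM mulrA divff ?mul1r// pnatr_eq0. Qed.

Lemma exists_level j (y : R) : 0 < y <= 2 ^- j ->
  exists2 k, (j <= k)%N & 2 ^- k.+1 < y <= 2 ^- k.
Proof.
move=> /andP[y0 yj].
have ex : exists k, 2 ^- k < y.
  exists (Num.bound y^-1); rewrite invf_plt ?posrE ?exprn_gt0//.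
  apply: lt_trans (archi_boundP _) _; first by rewrite invr_ge0 ltW.
  by rewrite -natrX ltr_nat ltn_expl.
case: (ex_minnP ex) => -[|k] ky kmin.
  by have := lev_le (leq0n j); rewrite leNgt (lt_le_trans ky yj).
exists k; last by rewrite ky leNgt; apply/negP => /kmin; rewrite ltnn.
rewrite leqNgt; apply/negP => kj.
by have := lt_le_trans ky yj; rewrite ltNge lev_le.
Qed.

Lemma iter_half m j : iter m (fun u : R => u / 2) (2 ^- j) = 2 ^- (j + m).
Proof.
elim: m => [|m IH]; first by rewrite addn0.
by rewrite iterS IH addnS exprSr invfM.
Qed.

Lemma while_half j k (y : R) : (j <= k)%N -> 2 ^- k.+1 < y <= 2 ^- k ->
  while (fun u : R => y <= u) (fun u => u / 2) (2 ^- j) = 2 ^- k.+1.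
Proof.
move=> jk /andP[ky yk]; rewrite /while; case: pselect => [ex|[]]; last first.
  by exists (k.+1 - j)%N; rewrite iter_half -ltNge subnKC// leqW.
case: (ex_minnP ex) => m; rewrite iter_half -ltNge => my mmin.
congr (_ ^- _); apply/eqP; rewrite eqn_leq; apply/andP; split.
  suff : (m <= k.+1 - j)%N by lia.
  by apply: mmin; rewrite iter_half -ltNge subnKC// leqW.
rewrite ltnNge; apply/negP => jmk.
by have := lt_le_trans my yk; rewrite ltNge lev_le.
Qed.

Local Arguments Defs.step : simpl never.
Local Arguments clk : simpl never.
Notation step := (step (3 / 4 : R)).
Notation run := (run (3 / 4 : R)).

Lemma step_hire n i j k t (y : R) : (j <= k)%N -> 2 ^- k.+1 < y <= 2 ^- k ->
  step n i y (State (2 ^- j) t false) =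
  if (n < i + hire_len k)%N then (State (2 ^- k.+1) t.-1 true, hire_len k)
  else (State (2 ^- k.+1) (clk k.+1) false, hire_len k).
Proof.
move=> jk ky; rewrite /Defs.step (while_half jk ky) ceiln_hire_len ceiln_clk.
by case/andP: ky => _ yk; rewrite (le_trans yk (lev_le jk)).
Qed.

Lemma step_miss n i j t (y : R) : 2 ^- j.+1 < y ->
  step n i y (State (2 ^- j.+1) t.+1 false) =
  (if t == 0%N then State (2 ^- j) (clk j) false
   else State (2 ^- j.+1) t false, 0%N).
Proof.
by move=> jy; rewrite /Defs.step leNgt jy /= -levS ceiln_clk; case: ifP.
Qed.

(** Induction on the remaining steps with [s] fixed. The last hypothesis says that the current climb
    must have ended in a hire by time [s]. A contract that ends too early to cover [s] restores it
    for the next climb, by [hire_len_csum]. *)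
Lemma run_covers n x f i j t l s : (forall i, 0 < x i <= 1) ->
  (i + f)%N = n.+1 -> (0 < t <= clk j)%N -> (i <= s <= n)%N ->
  (i + t + csum j <= s.+1)%N ->
  exists i', (i <= i' <= n)%N /\
    (i' <= s < i' + run n i (State (2 ^- j) t false) l
                      [seq x u | u <- iota i (i' - i).+1])%N.
Proof.
move=> x01; elim: f i j t l => [|f IH] i j t l; first by lia.
move=> ifn /andP[t0 tj] /andP[il sn] ijs.
have next st' l' : step n i (x i) (State (2 ^- j) t false) = (st', l') ->
    (exists i', (i.+1 <= i' <= n)%N /\
     (i' <= s < i' + run n i.+1 st' l'
                      [seq x u | u <- iota i.+1 (i' - i.+1).+1])%N) ->
    exists i', (i <= i' <= n)%N /\
     (i' <= s < i' + run n i (State (2 ^- j) t false) l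
                      [seq x u | u <- iota i (i' - i).+1])%N.
  move=> est [i' [/andP[ii' i'n] h]]; exists i'; split; first by rewrite i'n ltnW.
  have -> : (i' - i = (i' - i.+1).+1)%N by lia.
  by move: h; rewrite /= est.
have [xj|jx] := leP (x i) (2 ^- j).
  have /exists_level[k jk kx] : 0 < x i <= 2 ^- j.
    by rewrite xj andbT; case/andP: (x01 i).
  case: (ltnP s (i + hire_len k)) => [sk|ks].
    exists i; split; first by lia.
    by rewrite subnn /= (step_hire n i t jk kx); case: ifP => _ /=; lia.
  have := step_hire n i t jk kx; rewrite ltnNge (leq_trans ks sn) /= => est.
  have c0 : (0 < hire_len k)%N by rewrite muln_gt0 expn_gt0.
  apply: next est _; apply: IH.
  - lia.
  - by rewrite clk_gt0 leqnn.
  - lia.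
  - by move: ks; rewrite hire_len_csum; lia.
case: j => [|j] in tj ijs jx next *.
  by move: jx; rewrite expr0 invr1 ltNge; case/andP: (x01 i) => _ ->.
case: t => [//|t] in t0 tj ijs next *.
have cs0 := clk_gt0 j; have csj := csumS j.
apply: next (step_miss n i t jx) _; case: eqVneq => [t0'|tn0].
  by apply: IH; rewrite ?clk_gt0 ?leqnn//; lia.
by apply: IH; lia.
Qed.

Lemma algorithm2_feasible n x : (forall i, 0 < x i <= 1) ->
  feasible n (durations (algorithm2 (3 / 4)) n x).
Proof.
move=> x01 s sn.
have [i' [i'n i's]] := @run_covers n x n 1 0 1 0 s x01 (add1n n) isT sn
  (andP sn).1.
exists i'; split => //; move: i's.
by rewrite /under_contract /durations /algorithm2 expr0 invr1 subn1 prednK //; lia.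
Qed.

Lemma truncated_feasible (A : online_algorithm R) n x :
  feasible n (durations A n x) -> feasible n (durations (truncated A) n x).
Proof.
move=> fA s sn; have [i [i_n iu]] := fA s sn; exists i; split => //.
move: iu; rewrite /under_contract /durations /truncated size_map size_iota.
lia.
Qed.

Fixpoint cost_from n f i (st : state R) x : R :=
  if f is f'.+1 then
    (step n i (x i) st).2%:R * x i +
    cost_from n f' i.+1 (step n i (x i) st).1 x
  else 0.

(** [durations] reruns the algorithm on every prefix. After [x i] all longer prefixes continue from
    the same state, so a single pass finds the same durations. *)
Lemma cost_from_run n f i st l x :
  \sum_(i <= s < i + f) (run n i st l [seq x u | u <- iota i (s - i).+1])%:R * x s
  = cost_from n f i st x.
Proof.
elim: f i st l => [|f IH] i st l; first by rewrite addn0 big_geq.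
rewrite big_ltn ?addnS ?ltnS ?leq_addr//= subnn /=.
rewrite [step n i (x i) st]surjective_pairing /=; congr (_ + _).
rewrite -addSn -(IH i.+1 _ (step n i (x i) st).2).
apply: eq_big_nat => s /andP[is_ _]; congr (_%:R * _).
by have -> : (s - i = (s - i.+1).+1)%N by lia.
Qed.

Lemma Alg_cost_from n x :
  Alg (algorithm2 (3 / 4)) n x = cost_from n n 1 (State (2 ^- 0) 1 false) x.
Proof.
rewrite -(cost_from_run _ _ _ _ 0) /Alg /cost add1n; apply: eq_big_nat => s.
case: s => // s _; rewrite /durations /algorithm2 subn1 /= expr0 invr1.
by [].
Qed.

Lemma Alg_truncated_le (A : online_algorithm R) n x :
  (forall i, 0 < x i <= 1) -> Alg (truncated A) n x <= Alg A n x.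
Proof.
move=> x01; rewrite /Alg /cost; apply: ler_sum => i _.
apply: ler_wpM2r; first by case/andP: (x01 i) => /ltW.
by rewrite ler_nat geq_minl.
Qed.

Lemma cost_from_stopped n f i tau t x : cost_from n f i (State tau t true) x = 0.
Proof. by elim: f i => //= f IH i; rewrite mul0r add0r IH. Qed.

End Dynamics.

(** * Expected cost of the algorithm *)

Section ExpectedCost.
Context d (T : measurableType d) (R : realType) (P : probability T R).
Variables (X : nat -> {RV P >-> R}) (iidX : iid X (uniform_prob (@ltr01 R))).
Variable n : nat.
Local Arguments Defs.step : simpl never.
Local Arguments clk : simpl never.
Local Arguments csum : simpl never.

Definition state_at j t : state R := State (2 ^- j) t false.

Definition after_hire i k t : state R :=
  if (n < i + hire_len k)%N then State (2 ^- k.+1) t true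
  else state_at k.+1 (clk k.+1).

Definition future f i st (w : T) : R := cost_from n f i st (X ^~ w).

Lemma future_hire f i j k t w : (j <= k)%N -> 2 ^- k.+1 < X i w <= 2 ^- k ->
  future f.+1 i (state_at j t) w =
  (hire_len k)%:R * X i w + future f i.+1 (after_hire i k t.-1) w.
Proof.
move=> jk kX; rewrite /future /= (step_hire _ _ _ jk kX) /after_hire.
by case: ifP.
Qed.

Lemma future_miss f i j t w : 2 ^- j.+1 < X i w ->
  future f.+1 i (state_at j.+1 t.+1) w =
  future f i.+1 (if t == 0%N then state_at j (clk j) else state_at j.+1 t) w.
Proof.
by move=> jX; rewrite /future /= (step_miss _ _ _ jX) /= mul0r add0r.
Qed.

(** This is [2 * c]. The hired cost averages 3/2 times the new threshold, whence 9/4 per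
    contract. *)
Lemma hire_len_lev k : (hire_len k)%:R * 2 ^- k.+1 = 3 / 2 :> R.
Proof.
rewrite natrM natrX exprS; have : 2 ^+ k != 0 :> R by rewrite expf_neq0// pnatr_eq0.
by move: (2 ^+ k) => p p0; field.
Qed.

Lemma cond_le_mono i f (u v : R) : u <= v ->
  cond_le X i f u -> cond_le X i f v.
Proof.
move=> uv [F [F0 mF fF IF]]; exists F; split => // E mE.
by apply: le_trans (IF E mE) _; rewrite lee_wpmul2l// lee_fin.
Qed.

(* A contract signed at threshold [2^-(k+1)] costs [9/4] on average, [v k]
   bounds the cost incurred after it, and [U j] the total cost of hiring at
   threshold [2^-j]. The terms [1/1000] and [2^-e] pay for replacing the
   average over ]0, 2^-j] by finitely many constant pieces. *)
Lemma cond_le_hire f i j t M (v U : nat -> R) e :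
  (forall k, (j <= k)%N ->
     cond_le X i.+1 (future f i.+1 (after_hire i k t.-1)) (v k)) ->
  (forall k, (M <= k)%N -> (n < i + hire_len k)%N) ->
  (forall k, (j <= k)%N -> 9 / 4 + 1 / 1000 + v k + U k.+1 <= 2 * U k) ->
  (forall k, (M <= k)%N -> 2 <= U k) ->
  (M <= j + e)%N ->
  cond_le_itv X i 0 (2 ^- j) (future f.+1 i (state_at j t))
    (2 ^- j * (U j + 2 ^- e)).
Proof.
move=> Hv Hstop HU U2.
suff gen k : (j <= k)%N -> (M <= k + e)%N ->
    cond_le_itv X i 0 (2 ^- k) (future f.+1 i (state_at j t))
      (2 ^- k * (U k + 2 ^- e)) by exact: gen.
elim: e k => [|e IH] k jk.
  rewrite addn0 => Mk; have k0 := lev_gt0 R k.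
  have stop : cond_le X i.+1 (fun=> 0) 0 by exact: cond_le0.
  (* A contract of level [k'] costs at most [hire_len k' * 2 ^- k'], which is 3, and ends the
     process; [2 <= U k] and the error [2 ^- 0] pay for it. *)
  apply: cond_le_itv_mono (cond_le_itv_leaf (K := 3) iidX (lexx 0) (ltW k0)
     (lev_le1 R k) _ _ stop) => //.
  - rewrite subr0 ler_pM2l// expr0 invr1; have := U2 k Mk; lra.
  - move=> w gw /exists_level[k' kk' kX].
    rewrite (future_hire _ _ (leq_trans jk kk') kX).
    rewrite /after_hire Hstop ?(leq_trans Mk)// /future cost_from_stopped lerD2r.
    case/andP: kX => _ Xk; have : (hire_len k')%:R * 2 ^- k'.+1 = 3 / 2 :> R.
      exact: hire_len_lev.
    have : (hire_len k')%:R * X i w <= (hire_len k')%:R * 2 ^- k' :> R.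
      exact: ler_wpM2l.
    by rewrite levS mulrCA => + h; rewrite h; lra.
rewrite addnS -addSn => Mke.
have p0 := lev_gt0 R k.+1.
have pk : 2 ^- k.+1 <= 2 ^- k :> R by rewrite lev_le.
apply: cond_le_itv_mono (cond_le_itv_glue (ltW p0) pk (IH _ (leqW jk) Mke)
  (cond_le_itv_linear iidX 10 (L := (hire_len k)%:R) (ltW p0) pk (lev_le1 R k) _ _
     (Hv k jk))) => //; last first.
  by move=> w gw kX; rewrite (future_hire _ _ jk kX).
have CL := hire_len_lev k; have HUk := HU k jk.
(* The excess of the upper Riemann sum after ten bisections, per unit of threshold. *)
have eps : 3 / 2 / 2 ^+ 11 <= 1 / 1000 :> R.
  have -> : 2 ^+ 11 = 2 * (2 ^+ 5 * 2 ^+ 5) :> R by rewrite -exprD -exprS.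
  have -> : 2 ^+ 5 = 32 :> R by rewrite -natrX.
  by lra.
rewrite [2 ^- k]levS [2 ^- e]levS.
have z0 : 2 ^+ 11 != 0 :> R by rewrite expf_neq0// pnatr_eq0.
move: (2 ^- k.+1) (2 ^- e.+1) (2 ^+ 11) p0 CL HUk eps z0
  => p y z p0 CL HUk eps z0.
move: (hire_len k)%:R CL => L CL.
have -> : (2 * p - p) * (L * ((p + 2 * p) / 2 + (2 * p - p) / z) + v k) =
  p * ((L * p) * (3 / 2) + (L * p) / z + v k) by field.
have -> : 2 * p * (U k + y) = p * (2 * (U k + y)) by ring.
by rewrite CL -mulrDr ler_pM2l//; lra.
Qed.

Variable delta : nat -> R.
Hypothesis delta_ge0 : forall j, 0 <= delta j.

(** The extra hires caused by a doubling: the difference of two consecutive values of [hires], plus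
    the correction [delta j'] for the fresh clock. At threshold 1 everybody is hired, hence 0. *)
Definition rho j : R := if j is j'.+1 then (1 + delta j) / 2 + delta j' else 0.

Hypothesis delta_rho : forall j,
  (1 - 2 ^- j) ^+ clk j * rho j <= delta j.

Variable m : nat.
Hypothesis m_gt0 : (0 < m)%N.
Hypothesis n_le : (n <= (hire_len m.-1).+1)%N.

(** The surplus 1/500 over 9/4 is exactly what the inequality for [U] in [cond_le_hire] consumes
    once [U] is lowered by 1/1000. *)
Definition kappa : R := 9 / 4 + 1 / 500.
Definition hires j : R := 1 + \sum_(j.+1 <= i < m) (1 + delta i) / 2.
Definition hires_miss j t : R := hires j + (1 - 2 ^- j) ^+ t * rho j.

Lemma hiresS j : (j.+1 < m)%N -> hires j = hires j.+1 + (1 + delta j.+1) / 2.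
Proof. by move=> jm; rewrite /hires big_ltn// addrCA addrC. Qed.

Lemma hires1 j : (m <= j.+1)%N -> hires j = 1.
Proof. by move=> jm; rewrite /hires big_geq// addr0. Qed.

Lemma hires_ge1 j : 1 <= hires j.
Proof.
rewrite lerDl sumr_ge0// => i _; rewrite mulr_ge0// ?invr_ge0//.
by rewrite addr_ge0.
Qed.

Lemma hires_miss_le j : hires_miss j (clk j) <= hires j + delta j.
Proof. by rewrite lerD2l. Qed.

Lemma rho_ge0 j : 0 <= rho j.
Proof.
case: j => //= j; have := delta_ge0 j; have := delta_ge0 j.+1; lra.
Qed.

Lemma hires_climb j : (j < m)%N -> hires j + delta j <= hires j.+1 + rho j.+1.
Proof.
move=> jm /=; case: (ltnP j.+1 m) => [jm'|mj]; first by rewrite hiresS//; lra.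
by rewrite !hires1 ?(leq_trans mj)//; have := delta_ge0 j.+1; lra.
Qed.

Lemma kappa_gt0 : 0 < kappa. Proof. by rewrite /kappa; lra. Qed.

Lemma leq_hire_len k k' : (k <= k')%N -> (hire_len k <= hire_len k')%N.
Proof. by move=> kk'; rewrite leq_mul2l leq_exp2l. Qed.

Lemma ltn_hire_len k k' : (k < k')%N -> (hire_len k < hire_len k')%N.
Proof. by move=> kk'; rewrite ltn_mul2l ltn_exp2l. Qed.

Lemma lev_small k : 2 ^- (k + 10) <= 1 / 1000 :> R.
Proof.
apply: le_trans (lev_le R (leq_addl k 10)) _.
have -> : 2 ^+ 10 = 2 ^+ 5 * 2 ^+ 5 :> R by rewrite -exprD.
have -> : 2 ^+ 5 = 32 :> R by rewrite -natrX.
by lra.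
Qed.

(** Induction on the remaining steps. With [p = 2 ^- j], [h = hires j] and [r = rho j], separating
    hire and miss gives [p * h + (1 - p) * (h + (1 - p) ^+ t * r) = h + (1 - p) ^+ t.+1 * r]. When
    the clock runs out, [hires_climb] gives the bound with exponent 0. *)
Lemma future_le f i j t : (i + f)%N = n.+1 -> (1 < i)%N -> (j <= m)%N ->
  (0 < t <= clk j)%N ->
  cond_le X i (future f i (state_at j t)) (kappa * hires_miss j t).
Proof.
have kap := kappa_gt0.
elim: f i j t => [|f IH] i j t ifn i1 jm /andP[t0 tj].
  apply: cond_le0 => //; rewrite mulr_ge0 ?(ltW kap)// addr_ge0//.
    by apply: le_trans (hires_ge1 j).
  by rewrite mulr_ge0 ?rho_ge0// exprn_ge0// subr_ge0 lev_le1.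
have hire : cond_le_itv X i 0 (2 ^- j) (future f.+1 i (state_at j t))
    (2 ^- j * (kappa * hires j)).
  (* As [1 < i], a contract of level at least [m.-1] ends past [n] and stops the process, so nothing
     follows it. *)
  pose v k := if (k.+1 < m)%N then kappa * (hires k.+1 + delta k.+1) else 0.
  pose U k := kappa * hires k - 1 / 1000.
  apply: cond_le_itv_mono (@cond_le_hire f i j t m v U (m + 10) _ _ _ _ _).
  - rewrite ler_pM2l ?lev_gt0// /U; have := lev_small m; lra.
  - move=> k jk; rewrite /v /after_hire; case: ifPn => [_|].
      apply: cond_le0 => [|w _]; last by rewrite /future cost_from_stopped.
      case: ifP => // _; rewrite mulr_ge0 ?(ltW kap)// addr_ge0//.
      exact: le_trans (hires_ge1 _).
    rewrite -leqNgt => hk; case: ltnP => km.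
      apply: cond_le_mono (IH _ _ _ _ _ _ _); rewrite ?addSnnS ?clk_gt0 ?leqnn//.
      - by rewrite ler_pM2l// hires_miss_le.
      - exact: leqW.
      - exact: ltnW.
    have := @leq_hire_len m.-1 k; lia.
  - by move=> k mk; have := @leq_hire_len m.-1 k; lia.
  - move=> k jk; rewrite /v /U; case: ltnP => km.
      by rewrite (hiresS km) /kappa; lra.
    by rewrite !hires1 ?(leqW km)// /kappa; lra.
  - by move=> k mk; rewrite /U hires1 ?leqW// /kappa; lra.
  - by rewrite addnCA leq_addr.
apply: cond_le_of_itv; case: j => [|j] in jm tj hire *.
  by move: hire; rewrite /hires_miss /= mulr0 addr0 expr0 invr1 mul1r.
case: t => // t in t0 tj hire *.
have l1 := lev_le1 R j.+1.
have miss : cond_le X i.+1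
   (future f i.+1 (if t == 0%N then state_at j (clk j) else state_at j.+1 t))
   (kappa * hires_miss j.+1 t).
  case: eqVneq => [->|tn0]; last by apply: IH => //; lia.
  apply: cond_le_mono (IH _ _ _ _ _ _ _); rewrite ?addSnnS ?clk_gt0 ?leqnn//.
  - rewrite ler_pM2l// (le_trans (hires_miss_le j))// /hires_miss expr0 mul1r.
    exact: hires_climb.
  - exact: leqW.
  - exact: ltnW.
apply: cond_le_itv_mono (cond_le_itv_glue (ltW (lev_gt0 R _)) l1 hire
  (cond_le_itv_leaf iidX (ltW (lev_gt0 R _)) l1 (lexx 1) (lexx 0) _ miss)).
  rewrite /hires_miss add0r [in leRHS]exprS.
  move: (hires j.+1) (rho j.+1) (2 ^- j.+1) => h r p.
  by move: ((1 - p) ^+ t) => z; rewrite le_eqVlt; apply/orP; left; apply/eqP; ring.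
by move=> w gw /andP[jX _]; rewrite add0r (future_miss _ _ jX).
Qed.

(* Only the contract of applicant 1 can end exactly at [n - 1] with a threshold
   as low as [2^-m]; [x] is the price of that possibility. *)
Lemma expected_cost_le (x : R) : (0 < n)%N -> 0 <= x ->
  (n <= hire_len m.-1)%N \/ x = 1 + delta m ->
  cond_le X 1 (fun w => Alg (algorithm2 (3 / 4)) n (X ^~ w))
    (kappa * (hires 0 + 2 ^- m * x)).
Proof.
move=> n0 x0 hx; have kap := kappa_gt0; case En : n n0 => [//|f] _.
pose v k := if (k.+1 < m)%N then kappa * (hires k.+1 + delta k.+1)
            else if k.+1 == m then kappa * x else 0.
(* Given that the first cost is at most [2 ^- k], with [k < m], it has level [m.-1] with probability
   [2 ^- m * 2 ^+ k]; [kappa * x] is charged in that event. *)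
pose U k := kappa * (hires k + (if (k < m)%N then 2 ^- m * 2 ^+ k * x else 0))
            - 1 / 1000.
have U2 k : 2 <= U k.
  have : kappa * 1 <= kappa *
      (hires k + (if (k < m)%N then 2 ^- m * 2 ^+ k * x else 0)).
    rewrite ler_pM2l// -[leLHS]addr0 lerD ?hires_ge1//; case: ifP => // _.
    by rewrite !mulr_ge0// ?invr_ge0 exprn_ge0.
  rewrite /U /kappa; lra.
have v0 k : 0 <= v k.
  rewrite /v; case: ifP => _.
    by rewrite mulr_ge0 ?(ltW kap)// addr_ge0// (le_trans _ (hires_ge1 _)).
  by case: ifP => // _; rewrite mulr_ge0// ltW.
have hire : cond_le_itv X 1 0 (2 ^- 0) (future f.+1 1 (state_at 0 1))
    (2 ^- 0 * (U 0 + 2 ^- (m + 10))).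
  apply: (@cond_le_hire f 1 0 1 m v U (m + 10)) => //.
  - move=> k _; rewrite /after_hire; case: ifPn => [_|].
      by apply: cond_le0 => [|w _] //; rewrite /future cost_from_stopped.
    rewrite -leqNgt => hk.
    have km : (k.+1 <= m)%N.
      rewrite leqNgt; apply/negP => mk.
      have := @ltn_hire_len m.-1 k; lia.
    apply: cond_le_mono (future_le _ _ km _); rewrite ?clk_gt0 ?leqnn//; last lia.
    apply: le_trans (_ : kappa * (hires k.+1 + delta k.+1) <= _).
      by rewrite ler_pM2l// hires_miss_le.
    rewrite /v; case: ltnP => // mk; have km' : k.+1 = m by lia.
    rewrite km' eqxx hires1 ?leqnn// ?leqW//; case: hx => [nm|->//].
    by move: hk nm; rewrite -km' /=; lia.
  - by move=> k mk; have := @ltn_hire_len m.-1 k; lia.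
  - move=> k _; rewrite /v /U; case: (ltngtP k.+1 m) => km.
    + by rewrite (hiresS km) [2 ^+ k.+1]exprS /kappa; lra.
    + by rewrite !hires1 ?leqW// /kappa; lra.
    + rewrite !hires1 ?km ?leqnn ?leqW//.
      have -> : 2 ^- m * 2 ^+ k = 2^-1 :> R.
        by rewrite -km exprS invfM mulfVK// expf_neq0// pnatr_eq0.
      rewrite /kappa; lra.
  - by rewrite add0n leq_addr.
apply: cond_le_of_itv.
have e0 : 2 ^- 0 = 1 :> R by rewrite expr0 invr1.
move: hire; rewrite [X in cond_le_itv _ _ _ X]e0.
have le1 : 2 ^- 0 * (U 0 + 2 ^- (m + 10)) <= kappa * (hires 0 + 2 ^- m * x).
  by rewrite e0 mul1r /U m_gt0 expr0 mulr1; have := lev_small m; lra.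
move=> /(cond_le_itv_mono le1) [F [F0 mF fF IF]]; exists F; split => // w gw hw.
rewrite Alg_cost_from -En; move: (fF w gw hw).
by rewrite /future En.
Qed.

End ExpectedCost.

(** * Lower bound on the expected optimum *)

Section OptLowerBound.

Lemma sum_contract_steps n i t :
  (\sum_(1 <= s < n.+1) (i <= s < i + t) <= minn t (n.+1 - i))%N.
Proof.
elim: n => [|n IH]; first by rewrite big_geq.
rewrite big_nat_recr//=; case: (boolP (i <= n.+1 < i + t)%N); lia.
Qed.

(** Each step [s] is charged to an applicant under contract at [s], who arrived by then and so costs
    at least [y s]. After exchanging the sums, applicant [i] is charged for at most [t i] steps. *)
Lemma sum_le_Opt (R : realType) n (x y : nat -> R) : (forall i, 0 < x i) ->
  (forall s i, (1 <= i <= s)%N -> (s <= n)%N -> y s <= x i) ->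
  \sum_(1 <= s < n.+1) y s <= Opt n x.
Proof.
move=> x0 yx; apply: lb_le_inf.
  exists (cost n x (fun=> 1%N)); exists (fun=> 1%N) => // s sn; exists s.
  by split => //; rewrite /under_contract addn1 leqnn ltnS leqnn.
move=> _ [t ft <-]; rewrite /cost.
apply: le_trans (_ : \sum_(1 <= s < n.+1) \sum_(1 <= i < n.+1)
    (i <= s < i + t i)%:R * x i <= _).
  apply: ler_sum_nat => s /andP[s1 sn].
  have [|i [/andP[i1 i_n] isu]] := ft s; first by rewrite s1.
  rewrite (big_cat_nat (n := i))//=; last exact: leqW.
  rewrite [X in _ + X]big_ltn ?ltnS// (_ : (i <= s < i + t i)%N = true)// mul1r.
  apply: le_trans (yx s i _ _) _ => //; first by case/andP: isu => ->; rewrite i1.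
  rewrite addrCA lerDl addr_ge0// sumr_ge0// => k _;
    by rewrite mulr_ge0// ltW.
rewrite exchange_big_nat/=; apply: ler_sum_nat => i _.
rewrite -mulr_suml ler_wpM2r ?(ltW (x0 i))// -natr_sum ler_nat.
by apply: leq_trans (sum_contract_steps n i (t i)) _; rewrite geq_minl.
Qed.

Lemma ler_subX_deriv (R : realFieldType) (b c : R) s : 0 <= c -> c <= b ->
  b ^+ s.+1 - c ^+ s.+1 <= s.+1%:R * (b - c) * b ^+ s.
Proof.
move=> c0 cb; elim: s => [|s IH]; first by rewrite !expr1 expr0; lra.
have b0 : 0 <= b by exact: le_trans cb.
have h1 := ler_wpM2l c0 IH.
have h2 : (s.+1%:R * (b - c) * b ^+ s) * c <= (s.+1%:R * (b - c) * b ^+ s) * b.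
  by apply: ler_wpM2l => //; rewrite !mulr_ge0 ?exprn_ge0// subr_ge0.
rewrite -(natr1 s.+1) [c ^+ s.+2]exprS [b ^+ s.+2]exprS.
move: h1 h2; rewrite [b ^+ s.+1]exprS.
move: (b ^+ s) (c ^+ s.+1) (s.+1%:R : R) => B C z; lra.
Qed.

(* A lower Riemann sum for the integral of (1 - u)^s over [0, 1]. *)
Lemma sum_pow_ge (R : realFieldType) N s : (0 < N)%N -> (0 < s)%N ->
  s.+1%:R^-1 - N%:R^-1 <=
  N%:R^-1 * \sum_(1 <= k < N.+1) (1 - k%:R / N%:R) ^+ s :> R.
Proof.
move=> N0 s0; have Nn0 : N%:R != 0 :> R by rewrite pnatr_eq0 -lt0n.
pose a k : R := 1 - k%:R / N%:R.
have a0 k : (k <= N)%N -> 0 <= a k.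
  by move=> kN; rewrite subr_ge0 ler_pdivrMr ?ltr0n// mul1r ler_nat.
have tele K : (K <= N)%N ->
    1 - a K ^+ s.+1 <= s.+1%:R / N%:R * \sum_(0 <= k < K) a k ^+ s.
  elim: K => [|K IH] KN.
    by rewrite big_geq// mulr0 /a mul0r subr0 expr1n subrr.
  rewrite big_nat_recr//= mulrDr.
  have aS : a K - a K.+1 = N%:R^-1 by rewrite /a -natr1; field.
  have aK : a K.+1 <= a K by rewrite -subr_ge0 aS invr_ge0.
  have := ler_subX_deriv s (a0 _ KN) aK; rewrite aS.
  by have := IH (ltnW KN); lra.
have := tele N (leqnn N).
(* The telescoped left side is now 1. The term [k = 0] equals 1 and accounts for the loss of
   [N%:R^-1]; the term [k = N] vanishes since [0 < s]. *)
have aN : a N = 0 by rewrite /a divff// subrr.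
rewrite aN expr0n /= subr0 big_ltn// {1}/a mul0r subr0 expr1n.
have -> : \sum_(1 <= k < N.+1) a k ^+ s = \sum_(1 <= k < N) a k ^+ s.
  by rewrite big_nat_recr//= aN expr0n; case: s s0 {tele} => //= s _; rewrite addr0.
move: (\sum_(1 <= k < N) _) => Z.
have S0 : 0 < s.+1%:R :> R by rewrite ltr0n.
by rewrite -mulrA mulrC -ler_pdivrMr// div1r mulrDr mulr1 lerBlDl.
Qed.

Lemma count_lt_le (R : realFieldType) M (z : R) : 0 <= z ->
  \sum_(1 <= k < M.+1) ((k%:R < z)%R)%:R <= z.
Proof.
move=> z0; elim: M => [|M IH]; first by rewrite big_geq.
rewrite big_nat_recr//=; case: ltP => [Mz|_]; last by rewrite addr0.
apply: le_trans (ltW Mz); rewrite -natr1 lerD2r.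
apply: le_trans (_ : \sum_(1 <= k < M.+1) 1 <= _).
  by apply: ler_sum => k _; rewrite lern1 leq_b1.
by rewrite big_const_nat subn1 /= iter_addr_0.
Qed.

Context d (T : measurableType d) (R : realType) (P : probability T R).
Variables (X : nat -> {RV P >-> R}) (iidX : iid X (uniform_prob (@ltr01 R))).

(** Encoded as a box to use its product formula. Index 0 is left free since applicants are numbered
    from 1, which leaves [s] factors. *)
Definition all_above (u : R) s : set T :=
  box X (fun j => if j == 0%N then setT else `]u, 1]%classic) s.+1.

Lemma measurable_all_above u s : measurable (all_above u s).
Proof. by apply: measurable_box => j; case: ifP. Qed.

Lemma prob_all_above u s : 0 <= u <= 1 ->
  P (all_above u s) = ((1 - u) ^+ s)%:E.
Proof.
move=> /andP[u0 u1]; rewrite (prob_box iidX); last by move=> j; case: ifP.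
rewrite big_ord_recl/= preimage_setT probability_setT mul1e.
under eq_bigr do rewrite (prob_rv_itv iidX)//.
elim: s => [|s IH]; first by rewrite big_ord0.
by rewrite big_ord_recr/= IH -EFinM exprSr.
Qed.

Lemma expectation_Opt_ge_step n N : (0 < N)%N ->
  ((\sum_(1 <= s < n.+1) (s.+1%:R^-1 - N%:R^-1))%:E <=
   'E_P[fun w => Opt n (X ^~ w)])%E.
Proof.
move=> N0; have N0R : 0 < N%:R :> R by rewrite ltr0n.
(* The fraction of grid points lying below all of the first [s] costs: at most their minimum by
   [count_lt_le], and in expectation a Riemann sum of [(1 - u) ^+ s]. *)
pose g s w : R := N%:R^-1 * \sum_(1 <= k < N.+1) \1_(all_above (k%:R / N%:R) s) w.
pose G w : \bar R := (\sum_(1 <= s < n.+1) \sum_(1 <= k < N.+1)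
   (N%:R^-1)%:E * (\1_(all_above (k%:R / N%:R) s) w)%:E)%E.
have mi k s : measurable_fun setT
    (fun w => (N%:R^-1)%:E * (\1_(all_above (k%:R / N%:R) s) w)%:E : \bar R)%E.
  apply: measurable_funeM; apply/measurable_EFinP.
  exact/measurable_indic/measurable_all_above.
have i0 k s w : (0 <= (N%:R^-1 : R)%:E * (\1_(all_above (k%:R / N%:R) s) w)%:E)%E.
  by rewrite mule_ge0// lee_fin ?invr_ge0.
have GE w : G w = (\sum_(1 <= s < n.+1) g s w)%:E.
  rewrite /G -sumEFin; apply: eq_bigr => s _; rewrite /g mulr_sumr -sumEFin.
  by apply: eq_bigr.
apply: le_trans (_ : \int[P]_w G w <= _)%E; last first.
  apply: ge_expectation_ae.
  - by move=> w; rewrite /G sume_ge0// => s _; rewrite sume_ge0.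
  - by do 2 (apply: emeasurable_sum => ?).
  - apply: filterS (ae_unit_valued iidX) => w gw; rewrite GE lee_fin.
    apply: sum_le_Opt => [i|s i /andP[i1 i_s] _]; first by case/andP: (gw i).
    have Xi0 : 0 <= X i w by case/andP: (gw i) => /ltW.
    rewrite /g mulrC ler_pdivrMr// mulrC.
    apply: le_trans (count_lt_le N (mulr_ge0 (ltW N0R) Xi0)).
    apply: ler_sum => k _; rewrite indicE; case: (boolP (w \in _)) => //.
    rewrite inE => /(_ i); rewrite /= ltnS i_s (gtn_eqF i1) => /(_ isT).
    by rewrite /= in_itv/= => /andP[+ _]; rewrite ltr_pdivrMr// mulrC => ->.
rewrite /G ge0_integral_sum//; last 2 first.
  - by move=> s; apply: emeasurable_sum => ?.
  - by move=> s w _; rewrite sume_ge0.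
rewrite -sumEFin big_nat [leRHS]big_nat; apply: lee_sum => s /andP[s1 _].
rewrite ge0_integral_sum//.
apply: le_trans (_ : (N%:R^-1 * \sum_(1 <= k < N.+1) (1 - k%:R / N%:R) ^+ s)%:E <= _)%E.
  by rewrite lee_fin sum_pow_ge.
rewrite mulr_sumr -sumEFin big_nat [leRHS]big_nat; apply: lee_sum => k /andP[k1 kN].
have mI := measurable_all_above (k%:R / N%:R) s.
rewrite ge0_integralZl_EFin ?invr_ge0//; last exact/measurable_EFinP/measurable_indic.
rewrite integral_indic//.
have k01 : 0 <= (k%:R / N%:R : R) <= 1.
  by apply/andP; split; [exact: divr_ge0|rewrite ler_pdivrMr// mul1r ler_nat].
by rewrite setIT EFinM [X in (_ <= _ * X)%E](prob_all_above s k01).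
Qed.

Lemma expectation_Opt_ge n :
  ((\sum_(1 <= s < n.+1) s.+1%:R^-1)%:E <= 'E_P[fun w => Opt n (X ^~ w)])%E.
Proof.
apply/lee_subgt0Pr => e e0.
pose N := (Num.bound (n%:R / e)).+1.
have N0 : (0 < N)%N by [].
apply: le_trans (expectation_Opt_ge_step n N0).
rewrite -EFinB lee_fin sumrB lerD2l lerN2 big_const_nat subn1 /= iter_addr_0.
rewrite -[_ *+ n]mulr_natl ler_pdivrMr ?ltr0n// mulrC -ler_pdivrMr//.
apply: le_trans (ltW (archi_boundP _)) _; first by rewrite divr_ge0// ltW.
by rewrite ler_nat.
Qed.

End OptLowerBound.

(** * Numerical comparison of hires with harmonic sums *)

Section Numerics.
Variable R : realType.

(* Each entry is a fraction slightly above the smallest value allowed by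
   [gap_rho]; the last one is a fixed point of that recursion. *)
Definition gap j : R :=
  nth (22 / 27) [:: 0; 1 / 7; 11 / 32; 22 / 45; 16 / 27; 2 / 3; 21 / 29; 22 / 29] j.

Lemma gapE j : gap j.+4.+4 = 22 / 27.
Proof. by rewrite /gap nth_default. Qed.

Lemma gap_ge0 j : 0 <= gap j.
Proof.
case: (ltnP j 8) => [|/subnK <-]; last by rewrite addnC gapE; lra.
by move: j; do 8 (case; first by rewrite /gap /=; lra).
Qed.

Lemma pow_le_expR (x : R) n : -1 <= x -> (1 + x) ^+ n <= expR (n%:R * x).
Proof.
move=> x1; rewrite expRM_natl; apply: lerXn2r; rewrite ?nnegrE ?expR_ge0//.
- by lra.
- exact: expR_ge1Dx.
Qed.

Lemma expR_N34_le : expR (- (3 / 4)) <= 473 / 1000 :> R.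
Proof.
have E : 256 * (3 / 1024) = 3 / 4 :> R by lra.
have x1 : -1 <= 3 / 1024 :> R by lra.
have := pow_le_expR 256 x1; rewrite E expRN => h.
rewrite -div1r ler_pdivrMr; last exact: expR_gt0.
by move: (expR _) h => y h; lra.
Qed.

(** The exponent times [2 ^- j.+2] is exactly 3/4, so the power is at most [expR (- (3 / 4))]. *)
Lemma decay_le j : (1 - 2 ^- j.+2) ^+ clk j.+2 <= 473 / 1000 :> R.
Proof.
apply: le_trans expR_N34_le.
apply: le_trans (pow_le_expR (clk j.+2) _) _; first by rewrite lerN2 lev_le1.
rewrite ler_expR /clk natrM natrX !exprS.
have : 2 ^+ j != 0 :> R by rewrite expf_neq0// pnatr_eq0.
by move: (2 ^+ j) => p p0; rewrite le_eqVlt; apply/orP; left; apply/eqP; field.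
Qed.

Lemma gap_rho j : (1 - 2 ^- j) ^+ clk j * rho gap j <= gap j.
Proof.
(* The powers are evaluated exactly for [j < 6]; from there on the uniform decay 473/1000 is sharp
   enough. *)
case: (ltnP j 6) => [|/subnK <-].
  move: j; do 6 (case; first by rewrite /rho /gap /clk /=; lra).
  by [].
rewrite addnC; move: (j - 6)%N => {}j.
apply: le_trans (_ : 473 / 1000 * rho gap (6 + j) <= _).
  by rewrite ler_wpM2r ?rho_ge0// ?decay_le//; exact: gap_ge0.
case: j => [|[|[|j]]]; rewrite /rho /=; [rewrite /gap /=; lra..|].
by rewrite !gapE; lra.
Qed.

(** The harmonic number minus 1; [harm n.+1] is the lower bound on the expected optimum for [n]
    steps. *)
Definition harm n : R := \sum_(2 <= i < n.+1) i%:R^-1.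

Lemma harm_le a b : (a <= b)%N -> harm a <= harm b.
Proof.
move=> ab; rewrite /harm.
case: (leqP 2 a.+1) => [a2|]; last first.
  by move=> a1; rewrite big_geq 1?ltnW// sumr_ge0// => i _; rewrite invr_ge0.
by rewrite (big_cat_nat (n := a.+1) (p := b.+1))//= lerDl sumr_ge0.
Qed.

Lemma harmS n : (0 < n)%N -> harm n.+1 = harm n + n.+1%:R^-1.
Proof. by move=> n0; rewrite /harm big_nat_recr. Qed.

(* The tangent to 1/i at the midpoint of the block. *)
Lemma harm_block a l N : (0 < a)%N -> N = (2 * a + l + 1)%N ->
  harm a + 2 * l%:R / N%:R <= harm (a + l).
Proof.
move=> a0 ->; rewrite (natrD _ (2 * a + l)) (natrD _ (2 * a)) natrM.
pose c : R := (2 * a%:R + l%:R + 1) / 2.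
have c0 : 0 < c by rewrite divr_gt0// ltr_wpDl ?addr_ge0 ?mulr_ge0.
suff gen k : harm a + (2 * k%:R / c - (2 * a%:R + k%:R + 1) / 2 * k%:R / c ^+ 2)
    <= harm (a + k).
  apply: le_trans (gen l); rewrite lerD2l -/c le_eqVlt; apply/orP; left; apply/eqP.
  have -> : 2 * a%:R + l%:R + 1 = 2 * c by rewrite /c; lra.
  by field; rewrite gt_eqF.
elim: k => [|k IH]; first by rewrite !(mulr0, mul0r) subr0 addr0 addn0.
rewrite addnS harmS ?addn_gt0 ?a0//.
have i0 : 0 < (a + k).+1%:R :> R by rewrite ltr0n.
have tan : 2 / c - (a + k).+1%:R / c ^+ 2 <= (a + k).+1%:R^-1.
  rewrite -subr_ge0.
  have -> : (a + k).+1%:R^-1 - (2 / c - (a + k).+1%:R / c ^+ 2) =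
    ((a + k).+1%:R - c) ^+ 2 / ((a + k).+1%:R * c ^+ 2).
    by move: (a + k).+1%:R i0 => z z0; field; rewrite !gt_eqF.
  by rewrite divr_ge0 ?sqr_ge0// mulr_ge0 ?sqr_ge0// ltW.
apply: le_trans (lerD IH tan); rewrite -[leRHS]addrA lerD2l.
rewrite -[(a + k).+1%:R]natr1 -[k.+1%:R]natr1 natrD.
move: (a%:R : R) (k%:R : R) => a' k'.
by rewrite le_eqVlt; apply/orP; left; apply/eqP; field; rewrite gt_eqF.
Qed.

Local Notation hires0 m := (hires gap m 0).

Lemma hires0S m : (0 < m)%N -> hires0 m.+1 = hires0 m + (1 + gap m) / 2.
Proof. by move=> m0; rewrite /hires big_nat_recr//= addrA. Qed.

Lemma hires0_1 : hires0 1 = 1.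
Proof. by rewrite hires1. Qed.

Lemma harm1 : harm 1 = 0. Proof. by rewrite /harm big_geq. Qed.

Lemma harm6 : harm 6 = 1/2 + 1/3 + 1/4 + 1/5 + 1/6.
Proof.
by rewrite (@harmS 5)// (@harmS 4)// (@harmS 3)// (@harmS 2)// (@harmS 1)//
  harm1 add0r !div1r.
Qed.

Lemma harm9 : harm 9 = harm 6 + 1/7 + 1/8 + 1/9.
Proof. by rewrite (@harmS 8)// (@harmS 7)// (@harmS 6)// !div1r. Qed.

Lemma harm15_ge : 51 / 22 <= harm 15.
Proof.
rewrite (@harmS 14)// (@harmS 13)// (@harmS 12)// (@harmS 11)// (@harmS 10)//.
by rewrite (@harmS 9)// harm9 harm6; lra.
Qed.

Lemma harm27_ge : 211 / 73 <= harm 27.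
Proof.
have h := harm15_ge.
have b18 : harm 15 + 2 * 3 / 34 <= harm 18 := @harm_block 15 3 34 isT erefl.
have b21 : harm 18 + 2 * 3 / 40 <= harm 21 := @harm_block 18 3 40 isT erefl.
have b24 : harm 21 + 2 * 3 / 46 <= harm 24 := @harm_block 21 3 46 isT erefl.
have b27 : harm 24 + 2 * 3 / 52 <= harm 27 := @harm_block 24 3 52 isT erefl.
lra.
Qed.

Lemma harm51_ge : 429 / 122 <= harm 51.
Proof.
have h := harm27_ge.
have b33 : harm 27 + 2 * 6 / 61 <= harm 33 := @harm_block 27 6 61 isT erefl.
have b39 : harm 33 + 2 * 6 / 73 <= harm 39 := @harm_block 33 6 73 isT erefl.
have b45 : harm 39 + 2 * 6 / 85 <= harm 45 := @harm_block 39 6 85 isT erefl.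
have b51 : harm 45 + 2 * 6 / 97 <= harm 51 := @harm_block 45 6 97 isT erefl.
lra.
Qed.

Lemma harm99_ge : 530 / 127 <= harm 99.
Proof.
have h := harm51_ge.
have b63 : harm 51 + 2 * 12 / 115 <= harm 63 := @harm_block 51 12 115 isT erefl.
have b75 : harm 63 + 2 * 12 / 139 <= harm 75 := @harm_block 63 12 139 isT erefl.
have b87 : harm 75 + 2 * 12 / 163 <= harm 87 := @harm_block 75 12 163 isT erefl.
have b99 : harm 87 + 2 * 12 / 187 <= harm 99 := @harm_block 87 12 187 isT erefl.
lra.
Qed.

Lemma harm192_ge : 894 / 185 <= harm 192.
Proof.
have h := harm99_ge.
have b114 : harm 99 + 2 * 15 / 214 <= harm 114 := @harm_block 99 15 214 isT erefl.
have b129 : harm 114 + 2 * 15 / 244 <= harm 129 := @harm_block 114 15 244 isT erefl.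
have b144 : harm 129 + 2 * 15 / 274 <= harm 144 := @harm_block 129 15 274 isT erefl.
have b159 : harm 144 + 2 * 15 / 304 <= harm 159 := @harm_block 144 15 304 isT erefl.
have b174 : harm 159 + 2 * 15 / 334 <= harm 174 := @harm_block 159 15 334 isT erefl.
have b192 : harm 174 + 2 * 18 / 367 <= harm 192 := @harm_block 174 18 367 isT erefl.
lra.
Qed.

(** The gain [2B / ((2k + 1)B + 1)] of [harm_block] increases with [B]; this is its value at
    [B = 24]. *)
Lemma harm_block24 k B : (24 <= B)%N -> (0 < k)%N ->
  harm (k * B) + 48 / (48 * k + 25)%:R <= harm (k.+1 * B).
Proof.
move=> B24 k0; have kB0 : (0 < k * B)%N by rewrite muln_gt0 k0; lia.
have -> : (k.+1 * B = k * B + B)%N by rewrite mulSn addnC.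
apply: le_trans (@harm_block _ B _ kB0 erefl); rewrite lerD2l.
have p0 : 0 < (48 * k + 25)%:R :> R by rewrite ltr0n addnS.
have q0 : 0 < (2 * (k * B) + B + 1)%:R :> R by rewrite ltr0n addn1.
by rewrite ler_pdivrMr// mulrAC ler_pdivlMr// -!natrM ler_nat; nia.
Qed.

Lemma harm_double B : (24 <= B)%N -> harm (8 * B) + 69 / 100 <= harm (16 * B).
Proof.
move=> B24; have b k : (0 < k)%N -> _ := @harm_block24 k B B24.
have b8 : harm (8 * B) + 48 / 409 <= harm (9 * B) := b 8 isT.
have b9 : harm (9 * B) + 48 / 457 <= harm (10 * B) := b 9 isT.
have b10 : harm (10 * B) + 48 / 505 <= harm (11 * B) := b 10 isT.
have b11 : harm (11 * B) + 48 / 553 <= harm (12 * B) := b 11 isT.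
have b12 : harm (12 * B) + 48 / 601 <= harm (13 * B) := b 12 isT.
have b13 : harm (13 * B) + 48 / 649 <= harm (14 * B) := b 13 isT.
have b14 : harm (14 * B) + 48 / 697 <= harm (15 * B) := b 14 isT.
have b15 : harm (15 * B) + 48 / 745 <= harm (16 * B) := b 15 isT.
lra.
Qed.

Lemma hires0_table :
  [/\ hires0 2 = 1 + (1 + 1 / 7) / 2,
      hires0 3 = hires0 2 + (1 + 11 / 32) / 2,
      hires0 4 = hires0 3 + (1 + 22 / 45) / 2,
      hires0 5 = hires0 4 + (1 + 16 / 27) / 2 &
      [/\ hires0 6 = hires0 5 + (1 + 2 / 3) / 2,
          hires0 7 = hires0 6 + (1 + 21 / 29) / 2 &
          hires0 8 = hires0 7 + (1 + 22 / 29) / 2]].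
Proof.
split; [by rewrite hires0S// hires0_1 | exact: hires0S.. | ].
by split; exact: hires0S.
Qed.

(** Each further threshold adds [kappa * 49 / 54], about 2.0435, on the left and doubles the
    contract length, which by [harm_double] adds at least [2.965 * 0.69], about 2.0458, on the
    right. *)
Lemma hires0_harm8 j :
  kappa R * hires0 j.+4.+4 <= 593 / 200 * harm (hire_len j.+4.+2).
Proof.
elim: j => [|j IH].
  rewrite -[harm _]/(harm 192) /kappa; have := harm192_ge.
  by have [s2 s3 s4 s5 [s6 s7 s8]] := hires0_table; lra.
rewrite hires0S// gapE.
have B24 : (24 <= 24 * 2 ^ j)%N by rewrite leq_pmulr// expn_gt0.
have := harm_double B24.
have -> : (8 * (24 * 2 ^ j) = hire_len j.+4.+2)%N by rewrite /hire_len !expnS; lia.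
have -> : (16 * (24 * 2 ^ j) = hire_len j.+1.+4.+2)%N.
  by rewrite /hire_len !expnS; lia.
by move: IH; rewrite /kappa; lra.
Qed.

(** The least [n] that needs [m.+1] thresholds is [hire_len m.-1 + 2], hence the index of [harm].
    Small [m] are read off the table, the others follow by doubling. *)
Lemma hires0_harm m : (0 < m)%N ->
  kappa R * hires0 m.+1 <= 593 / 200 * harm (hire_len m.-1 + 3).
Proof.
move=> m0; case: (ltnP m 7) => [m7|/subnK m7]; last first.
  rewrite -m7 addnC; apply: le_trans (hires0_harm8 _) _.
  by rewrite ler_wpM2l// ?harm_le ?leq_addr//; lra.
have [s2 s3 s4 s5 [s6 s7 _]] := hires0_table.
move: harm6 harm9 harm15_ge harm27_ge harm51_ge harm99_ge => h6 h9 h15 h27 h51 h99.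
rewrite /kappa; case: m m0 m7 => [//|[|[|[|[|[|[|m]]]]]]] //= _ _.
- by rewrite -[harm _]/(harm 6); lra.
- by rewrite -[harm _]/(harm 9); lra.
- by rewrite -[harm _]/(harm 15); lra.
- by rewrite -[harm _]/(harm 27); lra.
- by rewrite -[harm _]/(harm 51); lra.
- by rewrite -[harm _]/(harm 99); lra.
Qed.

Lemma gap_le j : gap j <= 22 / 27.
Proof.
case: (ltnP j 8) => [|/subnK <-]; last by rewrite addnC gapE.
by move: j; do 8 (case; first by rewrite /gap /=; lra).
Qed.

(** Serves [n = (hire_len m).+1], where applicant 1 causes an extra term. With [A = hire_len m.-1],
    going from [A + 3] to [2A + 2] gains at least 4/15 in [harm], the value of the block bound at
    [A = 3], and this pays for the term. *)
Lemma hires0_harm_last m : (0 < m)%N ->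
  kappa R * (hires0 m.+1 + 2 ^- m.+1 * (1 + gap m.+1)) <=
  593 / 200 * harm (hire_len m + 2).
Proof.
move=> m0; have := hires0_harm m0.
have lenS : hire_len m = (2 * hire_len m.-1)%N.
  by rewrite /hire_len -{1}(prednK m0) expnS; lia.
have A3 : (3 <= hire_len m.-1)%N by rewrite leq_pmulr// expn_gt0.
rewrite {}lenS; move: (hire_len m.-1) A3 => A A3.
have A30 : (0 < A + 3)%N by rewrite addn3.
have := @harm_block (A + 3) (A - 1) (3 * A + 6) A30 _.
have -> : (A + 3 + (A - 1) = 2 * A + 2)%N by lia.
have -> : (3 * A + 6 = 2 * (A + 3) + (A - 1) + 1)%N by lia.
move=> /(_ erefl) bl.
have tail : 4 / 15 <= 2 * (A - 1)%:R / (2 * (A + 3) + (A - 1) + 1)%:R :> R.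
  have q0 : 0 < (2 * (A + 3) + (A - 1) + 1)%:R :> R by rewrite ltr0n addn1.
  by rewrite ler_pdivlMr// mulrAC ler_pdivrMr// -!natrM ler_nat; lia.
have price : kappa R * (2 ^- m.+1 * (1 + gap m.+1)) <= 593 / 200 * (4 / 15).
  case: m m0 => [//|[_|m _]]; first by rewrite /kappa /gap /=; lra.
  have l8 : 2 ^- m.+3 <= 1 / 8 :> R.
    by apply: le_trans (lev_le R (isT : (3 <= m.+3)%N)) _; lra.
  have g := gap_le m.+3; have g0 := gap_ge0 m.+3.
  have : 2 ^- m.+3 * (1 + gap m.+3) <= 1 / 8 * (1 + 22 / 27).
    by apply: ler_pM => //; lra.
  by rewrite /kappa; lra.
have {}bl : harm (A + 3) + 4 / 15 <= harm (2 * A + 2).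
  by apply: le_trans bl; rewrite lerD2l.
move=> h; rewrite mulrDr; apply: le_trans (lerD h price) _.
by rewrite -mulrDr ler_wpM2l//; lra.
Qed.

Lemma ratio_bound n : (2 <= n)%N -> exists m x,
  [/\ (0 < m)%N, (n <= (hire_len m.-1).+1)%N, 0 <= x,
      (n <= hire_len m.-1)%N \/ x = 1 + gap m &
      kappa R * (hires0 m + 2 ^- m * x) <= 593 / 200 * harm n.+1].
Proof.
move=> n2; have ex : exists k, (n <= (hire_len k).+1)%N.
  by exists n; have := ltn_expl n (isT : (1 < 2)%N); rewrite /hire_len; lia.
case: (ex_minnP ex) => k nk kmin; exists k.+1.
case: (leqP n (hire_len k)) => nk'.
  exists 0; split => //; first by left.
  rewrite mulr0 addr0; case: k => [|k] in nk kmin nk' *.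
    have h3 : harm 3 = 1 / 2 + 1 / 3.
      by rewrite (@harmS 2)// (@harmS 1)// harm1 add0r !div1r.
    have := harm_le (_ : (3 <= n.+1)%N); rewrite ltnS n2 => /(_ isT).
    by rewrite hires0_1 h3 /kappa; lra.
  apply: le_trans (hires0_harm (ltn0Sn k)) _; apply: ler_wpM2l; first by lra.
  by apply: harm_le; have := kmin k; rewrite ltnn /=; lia.
have En : n = (hire_len k).+1 by apply/eqP; rewrite eqn_leq nk.
exists (1 + gap k.+1); split => //; [by rewrite addr_ge0 ?gap_ge0 | by right | ].
rewrite En; case: k {ex nk kmin nk' En} => [|k].
  have h5 : harm 5 = 1 / 2 + 1 / 3 + 1 / 4 + 1 / 5.
    by rewrite (@harmS 4)// (@harmS 3)// (@harmS 2)// (@harmS 1)// harm1 add0r !div1r.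
  by rewrite -[harm _]/(harm 5) h5 hires0_1 /kappa /gap /=; lra.
by have := hires0_harm_last (ltn0Sn k); rewrite addn2.
Qed.

End Numerics.

(** * The competitive ratio *)

Lemma ediv_le (R : realType) (x y : \bar R) (a b c : R) : 0 <= c -> 0 < b ->
  (x <= a%:E)%E -> (b%:E <= y)%E -> a <= c * b -> (x / y <= c%:E)%E.
Proof.
move=> c0 b0 xa by_ acb; case: y by_ => [r| |] // => [|_]; last first.
  by rewrite invey mule0 lee_fin.
rewrite lee_fin => br; have r0 : 0 < r by exact: lt_le_trans br.
rewrite inver gt_eqF// lee_pdivrMr// -EFinM; apply: (le_trans xa).
by rewrite lee_fin (le_trans acb)// ler_wpM2l.
Qed.

(* A contract offered near the end may run past time step n. If the steps after
   n are not charged, the bound is a supremum over all n >= 1. If they are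
   charged in full, every hire costs 9/4 in expectation, which for n = 1 is
   9/2 times the optimum, and the bound is a supremum over all n >= 2. *)
Theorem theorem4p6 (R : realType) (d : measure_display) (T : measurableType d)
    (P : probability T R) (X : nat -> {RV P >-> R})
    (iidX : iid X (uniform_prob (@ltr01 R))) :
  strictly_competitive X (truncated (algorithm2 (3 / 4))) (2965 / 1000) /\
  competitive_on [set n | (2 <= n)%N] X (algorithm2 (3 / 4)) (2965 / 1000).
Proof.
have c0 : 0 <= 2965 / 1000 :> R by lra.
have OptE n : ((harm R n.+1)%:E <= 'E_P[fun w => Opt n (X ^~ w)])%E.
  by rewrite /harm big_add1; exact: expectation_Opt_ge.
have harm_gt0 n : (0 < n)%N -> 0 < harm R n.+1.
  move=> n0; apply: lt_le_trans (harm_le R (_ : (2 <= n.+1)%N)) => //.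
  by rewrite harmS// harm1 add0r invr_gt0.
have alg n : (2 <= n)%N -> exists2 v,
    cond_le X 1 (fun w => Alg (algorithm2 (3 / 4)) n (X ^~ w)) v &
    v <= 2965 / 1000 * harm R n.+1.
  move=> n2; have [m [x [m0 nm x0 xm le_v]]] := ratio_bound R n2.
  exists (kappa R * (hires (gap R) m 0 + 2 ^- m * x)).
    exact: (expected_cost_le iidX (gap_ge0 R) (gap_rho R) m0 nm (ltnW n2) x0 xm).
  by apply: (le_trans le_v); lra.
split; split => [n n1|].
- apply: filterS (ae_unit_valued iidX) => w gw.
  exact/truncated_feasible/algorithm2_feasible.
- apply: ge_ereal_sup => _ [n n1 <-]; rewrite /ratio.
  have [n2|n2] := ltnP 1 n.
    have [v [F [F0 mF AF IF]] le_v] := alg n n2.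
    apply: (ediv_le c0 (harm_gt0 n n1) _ (OptE n) le_v).
    apply: (@expectation_le_cond _ _ _ _ _ iidX 1); exists F; split => // w gw.
    by apply: le_trans (AF w gw); rewrite lee_fin; exact: Alg_truncated_le.
  have -> : n = 1%N by apply/eqP; rewrite eqn_leq n2.
  (* For [n = 1] the truncated contract lasts at most one step and costs at most 1, while the
     expected optimum is at least 1/2. *)
  apply: (ediv_le (a := 1) c0 (harm_gt0 1 isT) _ (OptE 1)); last first.
    by rewrite harmS// harm1 -[1.+1%:R]/(2 : R); lra.
  have : ('E_P[fun w => Alg (truncated (algorithm2 (3 / 4))) 1 (X ^~ w)] <=
      \int[P]_w (cst 1%E) w)%E.
    apply: le_expectation_ae => //; apply: filterS (ae_unit_valued iidX) => w gw.
    rewrite lee_fin /Alg /cost big_nat1 /durations /truncated /=.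
    have /andP[X0 X1] := gw 1%N; rewrite -[leRHS]mulr1.
    by apply: ler_pM => //; [exact: ltW | rewrite lern1 geq_minr].
  by rewrite integral_cst// mul1e [X in (_ <= X)%E](probability_setT P).
- apply: filterS (ae_unit_valued iidX) => w gw; exact: algorithm2_feasible.
- apply: ge_ereal_sup => _ [n n2 <-]; have [v Av le_v] := alg n n2.
  apply: (ediv_le c0 (harm_gt0 n (ltnW n2)) _ (OptE n) le_v).
  exact: expectation_le_cond Av.
Qed.
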